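(* Let $M$ be a de Morgan algebra, $D$ a bounded distributive lattice, and $A$ a sublattice of $\mathrm{Con}(M)\times\mathrm{Con}(D)$. Then $A$ is representable if and only if the following hold: (1) $A$ is closed under arbitrary joins; (2) $A$ is down-closed in the first coordinate: $(\theta_1,\theta_2)\in A$ and $\alpha\le\theta_1$ imply $(\alpha,\theta_2)\in A$; (3) there exists a lattice $(0,1)$-homomorphism $\varphi: M\to D$ such that for every principal congruence $\theta_1\in\mathrm{Con}(M)$ and every $\theta_2\in\mathrm{Con}(D)$, $(\theta_1,\theta_2)\in A\iff\mathrm{Con}(\varphi)(\theta_1)\subseteq\theta_2$.
   Context: An MS-algebra is an algebra $(L;\vee,\wedge,{}^{\circ},0,1)$ where $(L;\vee,\wedge,0,1)$ is a bounded distributive lattice and ${}^{\circ}$ is a unary operation with $x\le x^{\circ\circ}$, $(x\wedge y)^{\circ}=x^{\circ}\vee y^{\circ}$ and $1^{\circ}=0$; a de Morgan algebra is an MS-algebra with $x=x^{\circ\circ}$. For an MS-algebra $L$: $L^{\circ\circ}=\{x\mid x=x^{\circ\circ}\}$ (a de Morgan subalgebra), $D(L)=\{x\mid x^{\circ}=0\}$ (a filter). $L$ is principal if there is $d_L$ with $D(L)=\{x\mid x\ge d_L\}$ and $x=x^{\circ\circ}\wedge(x\vee d_L)$ for all $x$; then $D(L)$ is a bounded distributive lattice with bounds $d_L,1$. An MS-congruence pair of a principal MS-algebra $L$ is $(\theta_1,\theta_2)\in\mathrm{Con}(L^{\circ\circ})\times\mathrm{Con}(D(L))$ (de Morgan algebra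 congruences, resp. lattice congruences) such that $(a,b)\in\theta_1$ implies $(a\vee d_L,b\vee d_L)\in\theta_2$; $A(L)$ is the set of these. For a homomorphism $\tau:X\to Y$ and $\theta\in\mathrm{Con}(X)$, $\mathrm{Con}(\tau)(\theta)$ is the congruence of $Y$ generated by all pairs $(\tau(x),\tau(y))$, $(x,y)\in\theta$. A subset $A\subseteq\mathrm{Con}(M)\times\mathrm{Con}(D)$ is representable if there exist a principal MS-algebra $L$, a de Morgan algebra isomorphism $\tau_1:M\to L^{\circ\circ}$ and a bounded lattice isomorphism $\tau_2:D\to D(L)$ such that $A=\{(\theta_1,\theta_2)\mid(\mathrm{Con}(\tau_1)(\theta_1),\mathrm{Con}(\tau_2)(\theta_2))\in A(L)\}$. *)

(* Defs.v *)
From HB Require Import structures.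
From mathcomp Require Import all_boot all_order.
From mathcomp Require Import boolp classical_sets.

Set Implicit Arguments.
Unset Strict Implicit.
Unset Printing Implicit Defensive.

Import Order.Theory.

Local Open Scope classical_set_scope.
Local Open Scope order_scope.

HB.mixin Record TBDistrLattice_isMSAlgebra d (L : Type)
    of Order.TBDistrLattice d L := {
  circ : L -> L;
  le_circ2 : forall x, x <= circ (circ x);
  circI : forall x y, circ (x `&` y) = circ x `|` circ y;
  circ1 : circ \top = \bot;
}.

#[short(type="msAlgebraType")]
HB.structure Definition MSAlgebra d :=
  {L of TBDistrLattice_isMSAlgebra d L & Order.TBDistrLattice d L}.

HB.mixin Record MSAlgebra_isDeMorgan d (L : Type) of MSAlgebra d L := {
  circK : forall x : L, circ (circ x) = x;
}.

#[short(type="deMorganType")]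
HB.structure Definition DeMorgan d :=
  {L of MSAlgebra_isDeMorgan d L & MSAlgebra d L}.

(* [dmin] is the element d_L: it is the least element of D(L), hence unique,
   so that principality can be presented as a structure. *)
HB.mixin Record MSAlgebra_isPrincipal d (L : Type) of MSAlgebra d L := {
  dmin : L;
  circ_eq0 : forall x : L, (circ x == \bot) = (dmin <= x);
  circ2_decomp : forall x : L, x = circ (circ x) `&` (x `|` dmin);
}.

#[short(type="principalMSType")]
HB.structure Definition PrincipalMS d :=
  {L of MSAlgebra_isPrincipal d L & MSAlgebra d L}.

Section MSTheory.
Context {d : Order.disp_t} {L : msAlgebraType d}.
Implicit Types x y : L.

Lemma circ_anti x y : x <= y -> circ y <= circ x.
Proof. by move=> /meet_idPl xy; rewrite -[in leRHS]xy circI leUr. Qed.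

Lemma circ3 x : circ (circ (circ x)) = circ x.
Proof.
by apply/le_anti; rewrite circ_anti ?le_circ2 //= le_circ2.
Qed.

Lemma circ0 : circ \bot = \top :> L.
Proof. by apply/le_anti; rewrite lex1 -circ1 le_circ2. Qed.

Lemma circU x y : circ (x `|` y) = circ x `&` circ y.
Proof.
apply/le_anti/andP; split.
  by rewrite lexI !circ_anti ?leUl ?leUr.
apply: (le_trans (le_circ2 _)); rewrite circI; apply: circ_anti.
by apply: leU2; exact: le_circ2.
Qed.

End MSTheory.

Record skeleton d (L : msAlgebraType d) := Skeleton {
  skeleton_val : L;
  skeletonP : skeleton_val == circ (circ skeleton_val);
}.

Section Skeleton.
Context {d : Order.disp_t} {L : msAlgebraType d}.

HB.instance Definition _ := [isSub for @skeleton_val d L].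
HB.instance Definition _ := [Choice of skeleton L by <:].

Fact skeleton_meet : {in [pred x : L | x == circ (circ x)] &, forall x y,
  x `&` y \in [pred x : L | x == circ (circ x)]}.
Proof.
move=> x y; rewrite !inE => /eqP xE /eqP yE.
by rewrite circI circU -xE -yE.
Qed.

Fact skeleton_join : {in [pred x : L | x == circ (circ x)] &, forall x y,
  x `|` y \in [pred x : L | x == circ (circ x)]}.
Proof.
move=> x y; rewrite !inE => /eqP xE /eqP yE.
by rewrite circU circI -xE -yE.
Qed.

Fact skeleton_bot : \bot \in [pred x : L | x == circ (circ x)].
Proof. by rewrite inE circ0 circ1. Qed.

Fact skeleton_top : \top \in [pred x : L | x == circ (circ x)].
Proof. by rewrite inE circ1 circ0. Qed.

HB.instance Definition _ := Order.SubChoice_isTBSubLattice.Build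
  d L _ d (skeleton L) skeleton_meet skeleton_join skeleton_bot skeleton_top.

Lemma skeleton_valI (x y : skeleton L) : val (x `&` y) = val x `&` val y.
Proof. exact: Order.valI_subproof. Qed.

Lemma skeleton_valU (x y : skeleton L) : val (x `|` y) = val x `|` val y.
Proof. exact: Order.valU_subproof. Qed.

Lemma skeleton_val0 : val (\bot : skeleton L) = \bot.
Proof. exact: Order.val0_subproof. Qed.

Lemma skeleton_val1 : val (\top : skeleton L) = \top.
Proof. exact: Order.val1_subproof. Qed.

Fact skeleton_meetUl :
  @left_distributive (skeleton L) (skeleton L) Order.meet Order.join.
Proof.
by move=> x y z; apply: val_inj; rewrite !(skeleton_valI, skeleton_valU) meetUl.
Qed.

HB.instance Definition _ :=
  Order.Lattice_Meet_isDistrLattice.Build d (skeleton L) skeleton_meetUl.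

Fact circ_skeleton (x : skeleton L) :
  circ (val x) == circ (circ (circ (val x))).
Proof. by rewrite circ3. Qed.

Definition skeleton_circ (x : skeleton L) : skeleton L := 
  Skeleton (circ_skeleton x).

Fact skeleton_le_circ2 x : x <= skeleton_circ (skeleton_circ x).
Proof. by rewrite -Order.le_val /= le_circ2. Qed.

Fact skeleton_circI x y :
  skeleton_circ (x `&` y) = skeleton_circ x `|` skeleton_circ y.
Proof. by apply: val_inj; rewrite skeleton_valU -circI -skeleton_valI. Qed.

Fact skeleton_circ1 : skeleton_circ \top = \bot.
Proof. by apply: val_inj; rewrite skeleton_val0 -circ1 -skeleton_val1. Qed.

HB.instance Definition _ := TBDistrLattice_isMSAlgebra.Build d (skeleton L)
  skeleton_le_circ2 skeleton_circI skeleton_circ1.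

Fact skeleton_circK (x : skeleton L) : circ (circ x) = x.
Proof. by apply: val_inj; apply/esym/eqP/(valP x). Qed.

HB.instance Definition _ :=
  MSAlgebra_isDeMorgan.Build d (skeleton L) skeleton_circK.

End Skeleton.

Record dense d (L : msAlgebraType d) := Dense {
  dense_val : L;
  denseP : circ dense_val == \bot;
}.

Section Dense.
Context {d : Order.disp_t} {L : msAlgebraType d}.

HB.instance Definition _ := [isSub for @dense_val d L].
HB.instance Definition _ := [Choice of dense L by <:].

Fact dense_meet : {in [pred x : L | circ x == \bot] &, forall x y,
  x `&` y \in [pred x : L | circ x == \bot]}.
Proof.
by move=> x y; rewrite !inE => /eqP x0 /eqP y0; rewrite circI x0 y0 joinxx.
Qed.

Fact dense_join : {in [pred x : L | circ x == \bot] &, forall x y,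
  x `|` y \in [pred x : L | circ x == \bot]}.
Proof.
by move=> x y; rewrite !inE => /eqP x0 /eqP y0; rewrite circU x0 y0 meetxx.
Qed.

Fact dense_top : \top \in [pred x : L | circ x == \bot].
Proof. by rewrite inE circ1. Qed.

HB.instance Definition _ := Order.SubChoice_isTSubLattice.Build
  d L _ d (dense L) dense_meet dense_join dense_top.

Lemma dense_valI (x y : dense L) : val (x `&` y) = val x `&` val y.
Proof. exact: Order.valI_subproof. Qed.

Lemma dense_valU (x y : dense L) : val (x `|` y) = val x `|` val y.
Proof. exact: Order.valU_subproof. Qed.

Lemma dense_val1 : val (\top : dense L) = \top.
Proof. exact: Order.val1_subproof. Qed.

Fact dense_meetUl :
  @left_distributive (dense L) (dense L) Order.meet Order.join.
Proof.
by move=> x y z; apply: val_inj; rewrite !(dense_valI, dense_valU) meetUl.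
Qed.

HB.instance Definition _ :=
  Order.Lattice_Meet_isDistrLattice.Build d (dense L) dense_meetUl.

End Dense.

Section PrincipalDense.
Context {d : Order.disp_t} {L : principalMSType d}.

Fact circ_join_dmin (x : L) : circ (x `|` dmin) == \bot.
Proof. by rewrite circ_eq0 leUr. Qed.

Definition join_dmin (x : L) : dense L := Dense (circ_join_dmin x).

Fact circ_dmin : circ (dmin : L) == \bot.
Proof. by rewrite circ_eq0. Qed.

Fact dense_le0x (x : dense L) : Dense circ_dmin <= x.
Proof. by rewrite -Order.le_val /= -circ_eq0 (valP x). Qed.

HB.instance Definition _ := Order.hasBottom.Build d (dense L) dense_le0x.

End PrincipalDense.

(* Congruences of a lattice endowed with a set [F] of additional unary
   operations; the constants of the signature impose no condition. *)
Record is_congruence d (L : latticeType d) (F : set (L -> L))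
    (R : L -> L -> Prop) : Prop := IsCongruence {
  cong_refl : forall x, R x x;
  cong_sym : forall x y, R x y -> R y x;
  cong_trans : forall x y z, R x y -> R y z -> R x z;
  congI : forall x y x' y', R x y -> R x' y' -> R (x `&` x') (y `&` y');
  congU : forall x y x' y', R x y -> R x' y' -> R (x `|` x') (y `|` y');
  cong_op : forall f, F f -> forall x y, R x y -> R (f x) (f y);
}.

Record con d (L : latticeType d) (F : set (L -> L)) := Con {
  con_rel :> L -> L -> Prop;
  conP : is_congruence F con_rel;
}.

Notation lattice_con D := (@con _ D set0).
Notation ms_con M := (@con _ M [set @circ _ M]).

Fact con_display : Order.disp_t. Proof. exact: Order.Disp tt tt. Qed.

Section ConLattice.
Context {d : Order.disp_t} {L : latticeType d} {F : set (L -> L)}.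
Implicit Types (R : L -> L -> Prop) (th : con F) (S : set (con F)).

Lemma con_ext th th' : (forall x y, th x y <-> th' x y) -> th = th'.
Proof.
case: th th' => [R PR] [R' PR'] /= RR'.
have E : R = R' by apply/funext => x; apply/funext => y; apply/propext.
by case: _ / E in PR' RR' *; rewrite (Prop_irrelevance PR PR').
Qed.

HB.instance Definition _ := gen_eqMixin (con F).
HB.instance Definition _ := gen_choiceMixin (con F).

Fact con_capP S : is_congruence F (fun x y => forall th, S th -> th x y).
Proof.
split.
- by move=> x th _; exact: (cong_refl (conP th)).
- by move=> x y xy th /xy; exact: (cong_sym (conP th)).
- move=> x y z xy yz th Sth.
  exact: (cong_trans (conP th) (xy th Sth) (yz th Sth)).
- by move=> *; apply: (congI (conP _)); auto.
- by move=> *; apply: (congU (conP _)); auto.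
- by move=> f Ff *; apply: (cong_op (conP _)); auto.
Qed.

Definition con_inf S : con F := Con (con_capP S).

Definition cg R : con F := con_inf [set th | forall x y, R x y -> th x y].

Definition con_sup S : con F := cg (fun x y => exists2 th, S th & th x y).

Lemma cg_sub R x y : R x y -> cg R x y.
Proof. by move=> Rxy th; apply. Qed.

Lemma cg_min R th : (forall x y, R x y -> th x y) -> forall x y, cg R x y -> th x y.
Proof. by move=> Rth x y; apply. Qed.

Definition le_con th th' : bool := `[< forall x y, th x y -> th' x y >].

Fact le_con_refl : reflexive le_con.
Proof. by move=> th; apply/asboolP. Qed.

Fact le_con_anti : antisymmetric le_con.
Proof.
by move=> th th' /andP[/asboolP a /asboolP b]; apply: con_ext; split; auto.
Qed.

Fact le_con_trans : transitive le_con.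
Proof. by move=> b a c /asboolP ab /asboolP bc; apply/asboolP; auto. Qed.

HB.instance Definition _ := Order.Le_isPOrder.Build con_display (con F)
  le_con_refl le_con_anti le_con_trans.

Lemma le_conP th th' : reflect (forall x y, th x y -> th' x y) (th <= th').
Proof. exact: asboolP. Qed.

Fact con_lexI th th1 th2 :
  (th <= con_inf [set th1; th2]) = (th <= th1) && (th <= th2).
Proof.
apply/le_conP/andP => [h|[/le_conP h1 /le_conP h2] x y xy _ [->|->]]; auto.
by split; apply/le_conP => x y /h; apply; [left|right].
Qed.

Fact con_leUx th1 th2 th :
  (con_sup [set th1; th2] <= th) = (th1 <= th) && (th2 <= th).
Proof.
apply/le_conP/andP => [h|[/le_conP h1 /le_conP h2]].
  split; apply/le_conP => x y xy; apply/h/cg_sub.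
    by exists th1 => //; left.
  by exists th2 => //; right.
by apply: cg_min => x y [_ [->|->]]; auto.
Qed.

HB.instance Definition _ :=
  Order.POrder_MeetJoin_isLattice.Build con_display (con F) con_lexI con_leUx.

Definition principal_con th : Prop :=
  exists a b, th = cg (fun x y => x = a /\ y = b).

End ConLattice.

Arguments con_sup {d L F} S.

Lemma con_sup_supremum d (L : latticeType d) (F : set (L -> L))
  (S : set (con F)) : supremums S (con_sup S).
Proof.
split=> [th Sth|th ub]; apply/le_conP.
  by move=> x y xy; apply: cg_sub; exists th.
by apply: cg_min => x y [th' /ub /le_conP]; apply.
Qed.

(* Con(tau); the extra operations [F] and [G] of the two algebras are read off
   the types of the congruences. *)
Definition con_map d (X : latticeType d) (F : set (X -> X))
    d' (Y : latticeType d') (G : set (Y -> Y)) (tau : X -> Y)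
    (th : con F) : con G :=
  cg (fun u v => exists x y, [/\ th x y, u = tau x & v = tau y]).

Arguments con_map {d X F d' Y G} tau th.

(* The library's [{tblmorphism _ -> _}] only records the preservation of the
   bounds, not that of the lattice operations. *)
Definition lattice01_hom d (X : tbLatticeType d) d' (Y : tbLatticeType d')
    (f : X -> Y) : Prop :=
  [/\ {morph f : x y / x `&` y}, {morph f : x y / x `|` y},
      f \bot = \bot & f \top = \top].

Definition lattice01_iso d (X : tbLatticeType d) d' (Y : tbLatticeType d')
    (f : X -> Y) : Prop :=
  lattice01_hom f /\ bijective f.

Definition ms_iso d (X : msAlgebraType d) d' (Y : msAlgebraType d')
    (f : X -> Y) : Prop :=
  [/\ lattice01_hom f, {morph f : x / circ x} & bijective f].

Definition ms_con_pair d (L : principalMSType d) :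
    set (ms_con (skeleton L) *p lattice_con (dense L)) :=
  [set p : ms_con (skeleton L) *p lattice_con (dense L) |
     forall a b : skeleton L, p.1 a b ->
       p.2 (join_dmin (skeleton_val a)) (join_dmin (skeleton_val b))].

Definition representable d (M : deMorganType d) d' (D : tbDistrLatticeType d')
    (A : set (ms_con M *p lattice_con D)) : Prop :=
  exists (e : Order.disp_t) (L : principalMSType e)
         (tau1 : M -> skeleton L) (tau2 : D -> dense L),
    [/\ ms_iso tau1, lattice01_iso tau2 &
        A = [set p | ms_con_pair (con_map tau1 p.1, con_map tau2 p.2)]].

Definition sublattice d (T : latticeType d) (A : set T) : Prop :=
  forall x y, A x -> A y -> A (x `&` y) /\ A (x `|` y).

Section SubsetsOfConProduct.
Context {d : Order.disp_t} {M : deMorganType d}.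
Context {d' : Order.disp_t} {D : tbDistrLatticeType d'}.
Implicit Types A S : set (ms_con M *p lattice_con D).

Definition pair_sup S : ms_con M *p lattice_con D :=
  (con_sup [set p.1 | p in S], con_sup [set p.2 | p in S]).

Lemma pair_sup_supremum S : supremums S (pair_sup S).
Proof.
split=> [p Sp|p ub].
  by apply/andP; split; apply: (con_sup_supremum _).1; exists p.
by apply/andP; split; apply: (con_sup_supremum _).2 => _ [q /ub /andP[? ?] <-].
Qed.

Definition closed_joins A : Prop := forall S, S `<=` A -> A (pair_sup S).

Definition down_closed1 A : Prop :=
  forall (th1 al : ms_con M) (th2 : lattice_con D),
    A (th1, th2) -> al <= th1 -> A (al, th2).

End SubsetsOfConProduct.

(* Main.v *)
(** If a principal MS-algebra [L] represents [A], then the map [phi] that sends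
    [x] to [x \/ d_L] (read through the two isomorphisms) is a (0,1)-homomorphism
    and [A] consists of the pairs such that [Con(phi)(th1) <= th2].  Conversely,
    conditions (1) and (2) reduce membership in [A] to the case of a principal
    first coordinate, so that (3) describes [A] in the same way; and every
    [phi : M -> D] comes from the principal MS-algebra
    [{(x, y) | y <= phi x}], whose operation is [(x, y) |-> (circ x, phi (circ x))] and
    whose smallest dense element is [(1, 0)]. *)

Require Import Defs.
From HB Require Import structures.
From mathcomp Require Import all_boot all_order.
From mathcomp Require Import boolp classical_sets.

Import Order.Theory.

(** * Generated congruences under maps *)

Section ConMap.
Local Open Scope order_scope.
Context {d d' : Order.disp_t} {X : latticeType d} {Y : latticeType d'}.
Context {F : set (X -> X)} {G : set (Y -> Y)}.

Lemma con_map_le (tau : X -> Y) (th : con F) (th' : con G) :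
  con_map tau th <= th' <-> forall x y, th x y -> th' (tau x) (tau y).
Proof.
split=> [/le_conP le_th x y thxy|th_th'].
  by apply/le_th/cg_sub; exists x, y.
by apply/le_conP/cg_min => _ _ [x [y [/th_th' ? -> ->]]].
Qed.

Lemma is_congruence_preim (sigma : Y -> X) (th : con F) :
  {morph sigma : x y / x `&` y} -> {morph sigma : x y / x `|` y} ->
  (forall g, G g -> exists2 f, F f & forall u, sigma (g u) = f (sigma u)) ->
  is_congruence G (fun u v => th (sigma u) (sigma v)).
Proof.
move=> sI sU sG; have cth := conP th; split.
- by move=> x; apply: (cong_refl cth).
- by move=> x y; apply: (cong_sym cth).
- by move=> x y z; apply: (cong_trans cth).
- by move=> x y x' y'; rewrite !sI; apply: (congI cth).
- by move=> x y x' y'; rewrite !sU; apply: (congU cth).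
- by move=> g /sG[f Ff fE] x y; rewrite !fE; apply: (cong_op cth).
Qed.

(** The preimage of [th] under [sigma] is a congruence containing the generators of
    [con_map tau th], and at [tau x], [tau y] it reads [th x y]. *)
Lemma con_map_cancel (tau : X -> Y) (sigma : Y -> X) (th : con F) x y :
  {morph sigma : x y / x `&` y} -> {morph sigma : x y / x `|` y} ->
  (forall g, G g -> exists2 f, F f & forall u, sigma (g u) = f (sigma u)) ->
  cancel tau sigma ->
  (con_map tau th : con G) (tau x) (tau y) <-> th x y.
Proof.
move=> sI sU sG tauK; split=> [|thxy]; last by apply: cg_sub; exists x, y.
have := cg_min (th := Con (is_congruence_preim sigma th sI sU sG)).
move=> /(_ (fun u v => exists x y, [/\ th x y, u = tau x & v = tau y])).
by move=> h /h /=; rewrite !tauK; apply=> _ _ [a [b [? -> ->]]]; rewrite !tauK.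
Qed.

Lemma le_principal_con (th : con F) a b :
  th a b <-> (cg (fun x y => x = a /\ y = b) : con F) <= th.
Proof.
split=> [thab|/le_conP]; last by apply; apply: cg_sub.
by apply/le_conP/cg_min => _ _ [-> ->].
Qed.

End ConMap.

(** * Congruences along isomorphisms *)

Section Inverse.
Local Open Scope order_scope.
Context {d d' : Order.disp_t}.

Lemma lattice01_hom_inv (X : tbLatticeType d) (Y : tbLatticeType d')
    (tau : X -> Y) (sigma : Y -> X) :
  lattice01_hom tau -> cancel tau sigma -> cancel sigma tau ->
  lattice01_hom sigma.
Proof.
move=> [tI tU t0 t1] tauK sigmaK; split.
- by move=> u v; rewrite -{1}(sigmaK u) -{1}(sigmaK v) -tI tauK.
- by move=> u v; rewrite -{1}(sigmaK u) -{1}(sigmaK v) -tU tauK.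
- by rewrite -t0 tauK.
- by rewrite -t1 tauK.
Qed.

Lemma con_map_lattice_iso (X : tbLatticeType d) (Y : tbLatticeType d')
    (tau : X -> Y) (th : lattice_con X) x y :
  lattice01_iso tau ->
  (con_map tau th : lattice_con Y) (tau x) (tau y) <-> th x y.
Proof.
move=> [tau_hom [sigma tauK sigmaK]].
have [sI sU _ _] := lattice01_hom_inv _ _ _ _ tau_hom tauK sigmaK.
exact: con_map_cancel tauK.
Qed.

Lemma con_map_ms_iso (X : msAlgebraType d) (Y : msAlgebraType d')
    (tau : X -> Y) (th : ms_con X) x y :
  ms_iso tau -> (con_map tau th : ms_con Y) (tau x) (tau y) <-> th x y.
Proof.
move=> [tau_hom tau_circ [sigma tauK sigmaK]].
have [sI sU _ _] := lattice01_hom_inv _ _ _ _ tau_hom tauK sigmaK.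
apply: (con_map_cancel tau sigma) => // _ ->; exists (@circ _ X) => // u.
by rewrite -{1}(sigmaK u) -tau_circ tauK.
Qed.

End Inverse.

(** * Congruence pairs read through isomorphisms *)

Section Transport.
Local Open Scope order_scope.
Context {d d' e : Order.disp_t} {M : deMorganType d} {D : tbDistrLatticeType d'}.
Context {L : principalMSType e}.

Lemma join_dmin_hom :
  lattice01_hom (fun x : skeleton L => join_dmin (skeleton_val x)).
Proof.
split=> [x y|x y||]; apply: val_inj.
- by rewrite /= joinIl.
- by rewrite /= -{1}[dmin]joinxx joinACA.
- by rewrite /= join0x.
- by rewrite /= join1x.
Qed.

(** Along isomorphisms [con_map] both preserves and reflects related pairs, so the implication
    defining a congruence pair becomes the criterion [con_map_le] for [phi]. This serves an
    arbitrary representing [L] as well as the glued algebra. *)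
Lemma ms_con_pair_map (tau1 : M -> skeleton L) (tau2 : D -> dense L)
    (phi : M -> D) (th1 : ms_con M) (th2 : lattice_con D) :
  ms_iso tau1 -> lattice01_iso tau2 ->
  (forall x, join_dmin (skeleton_val (tau1 x)) = tau2 (phi x)) ->
  ms_con_pair (con_map tau1 th1, con_map tau2 th2) <->
  (con_map phi th1 : lattice_con D) <= th2.
Proof.
move=> iso1 iso2 phiE; rewrite con_map_le; split=> [pair12 x y thxy|phi12 a b].
  by apply/(con_map_lattice_iso _ _ tau2) => //; rewrite -!phiE;
    apply: pair12; apply/con_map_ms_iso.
have [_ _ [sigma _ sigmaK]] := iso1.
rewrite /= -(sigmaK a) -(sigmaK b) => /(con_map_ms_iso _ _ _ _ _ _ iso1).
by rewrite !phiE => /phi12 /(con_map_lattice_iso _ _ _ _ _ _ iso2).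
Qed.

End Transport.

(** * Pairs of congruences compatible with [phi] *)

Section CompatiblePairs.
Local Open Scope classical_set_scope.
Local Open Scope order_scope.
Context {d d' : Order.disp_t} {M : deMorganType d} {D : tbDistrLatticeType d'}.
Context (phi : M -> D).

Definition compatible_pairs : set (ms_con M *p lattice_con D) :=
  [set p | (con_map phi p.1 : lattice_con D) <= p.2].

Lemma compatible_pairs_down : down_closed1 compatible_pairs.
Proof.
move=> th1 al th2 /con_map_le le12 /le_conP le_al.
by apply/con_map_le => x y /le_al; apply: le12.
Qed.

(* The preimage of [psi] under [phi] need not respect [circ]; as [circ] is an
   involution, intersecting it with the preimage under [phi \o circ] gives the
   largest congruence of [M] below it. *)
Lemma is_congruence_preim_circ (psi : lattice_con D) : lattice01_hom phi ->
  is_congruence [set @circ _ M]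
    (fun a b => psi (phi a) (phi b) /\ psi (phi (circ a)) (phi (circ b))).
Proof.
move=> [pI pU _ _]; have cpsi := conP psi; split.
- by move=> x; split; apply: (cong_refl cpsi).
- by move=> x y [? ?]; split; apply: (cong_sym cpsi).
- by move=> x y z [? ?] [? ?]; split; apply: (cong_trans cpsi); eassumption.
(* [circ] exchanges meets and joins, so this case and the next each use both compatibilities of
   [psi]. *)
- move=> x y x' y' [? ?] [? ?]; rewrite !circI !pI !pU.
  by split; [apply: (congI cpsi)|apply: (congU cpsi)].
- move=> x y x' y' [? ?] [? ?]; rewrite !circU !pI !pU.
  by split; [apply: (congU cpsi)|apply: (congI cpsi)].
- by move=> _ -> x y [? ?]; rewrite !circK.
Qed.

(** Let [psi] be the join of the second coordinates. Each first coordinate respects [circ], hence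
    lies below the congruence of [is_congruence_preim_circ] for [psi]; so does their join. *)
Lemma compatible_pairs_joins : lattice01_hom phi ->
  closed_joins compatible_pairs.
Proof.
move=> phi_hom S S_compat.
have [psi psiE] : {psi | psi = (pair_sup S).2} by exists (pair_sup S).2.
suff : (pair_sup S).1 <= Con (is_congruence_preim_circ psi phi_hom).
  by move/le_conP=> le_sup; apply/con_map_le => x y /le_sup[]; rewrite psiE.
apply: (con_sup_supremum _).2 => _ [p Sp <-]; apply/le_conP => x y pxy.
have p2psi u v : p.2 u v -> psi u v.
  by move: u v; apply/le_conP; rewrite psiE;
    apply: (con_sup_supremum _).1; exists p.
have /con_map_le p12 := S_compat p Sp.
split; apply/p2psi/p12 => //.
exact: (cong_op (conP p.1)).
Qed.

(** For one inclusion, (2) shrinks [th1] to the principal congruence of a related pair, where (3)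
    applies. For the other, [th1] is the join of the principal congruences below it; (3) puts each
    of them, paired with [th2], in [A], and (1) joins them. *)
Lemma eq_compatible_pairs (A : set (ms_con M *p lattice_con D)) :
  closed_joins A -> down_closed1 A ->
  (forall (th1 : ms_con M) (th2 : lattice_con D), principal_con th1 ->
    A (th1, th2) <-> (con_map phi th1 <= th2)%O) ->
  A = compatible_pairs.
Proof.
move=> A_joins A_down A_principal; apply/seteqP.
split=> -[th1 th2] /=.
  move=> A12; apply/con_map_le => x y th1xy.
  have /con_map_le : (con_map phi
      (cg (fun u v => u = x /\ v = y) : ms_con M) : lattice_con D) <= th2.
    apply/A_principal; first by exists x, y.
    exact: A_down A12 ((le_principal_con _ _ _).1 th1xy).
  by apply; apply: cg_sub.
move=> /con_map_le th12.
pose cg2 a b : ms_con M := cg (fun u v => u = a /\ v = b).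
pose S : set (ms_con M *p lattice_con D) :=
  [set p | p.2 = th2 /\ exists a b, th1 a b /\ p.1 = cg2 a b].
have SA : S `<=` A.
  move=> [al be] [/= -> [a [b [th1ab ->]]]].
  apply/A_principal; first by exists a, b.
  apply/con_map_le => u v uv; apply/th12; move: u v uv; apply: cg_min.
  by move=> _ _ [-> ->].
suff -> : (th1, th2) = pair_sup S by exact: A_joins.
congr (_, _); apply/le_anti/andP; split.
- apply/le_conP => a b th1ab; apply: cg_sub; exists (cg2 a b); last exact: cg_sub.
  by exists (cg2 a b, th2) => //; split=> //; exists a, b.
- apply: (con_sup_supremum _).2 => _ [p [_ [a [b [th1ab ->]]]] <-].
  exact/le_principal_con.
(* The join of the second coordinates is [th2] only if [S] is nonempty; reflexivity of [th1] at
   [\bot] supplies a member. *)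
- apply: (con_sup_supremum _).1; exists (cg2 \bot \bot, th2) => //.
  by split=> //; exists \bot, \bot; split=> //; exact: (cong_refl (conP th1)).
- by apply: (con_sup_supremum _).2 => _ [p [-> _] <-].
Qed.

End CompatiblePairs.

(* The proof that [phi] is a homomorphism is a parameter of the type, so that
   the algebra structure can be inferred from it. *)
Record glued {d d' : Order.disp_t} {M : deMorganType d}
    {D : tbDistrLatticeType d'} {phi : M -> D} (phi_hom : lattice01_hom phi) :=
  Glued {
    glued_val : M *p D;
    gluedP : (glued_val.2 <= phi glued_val.1)%O;
  }.

(** * The principal MS-algebra of pairs below the graph of [phi] *)

Section GluedAlgebra.
Local Open Scope order_scope.
Context {d d' : Order.disp_t} {M : deMorganType d} {D : tbDistrLatticeType d'}.
Context {phi : M -> D} (phi_hom : lattice01_hom phi).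
Local Notation L := (glued phi_hom).
Local Notation L_val := (@glued_val d d' M D phi phi_hom).
Local Notation inL := [pred p : M *p D | p.2 <= phi p.1].

Let phiI : {morph phi : x y / x `&` y}. Proof. by case: phi_hom. Qed.
Let phiU : {morph phi : x y / x `|` y}. Proof. by case: phi_hom. Qed.
Let phi0 : phi \bot = \bot. Proof. by case: phi_hom. Qed.
Let phi1 : phi \top = \top. Proof. by case: phi_hom. Qed.

HB.instance Definition _ := [isSub for L_val].
HB.instance Definition _ := [Choice of L by <:].

Fact glued_meet : {in inL &, forall x y, x `&` y \in inL}.
Proof. by move=> x y; rewrite !inE /= phiI => *; apply: leI2. Qed.

Fact glued_join : {in inL &, forall x y, x `|` y \in inL}.
Proof. by move=> x y; rewrite !inE /= phiU => *; apply: leU2. Qed.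

Fact glued_bot : \bot \in inL. Proof. by rewrite inE /= le0x. Qed.

Fact glued_top : \top \in inL. Proof. by rewrite inE /= phi1. Qed.

HB.instance Definition _ := Order.SubChoice_isTBSubLattice.Build
  _ (M *p D)%type _ (Order.Disp tt tt) L glued_meet glued_join glued_bot glued_top.

Lemma glued_valI (x y : L) : val (x `&` y) = val x `&` val y.
Proof. exact: Order.valI_subproof. Qed.

Lemma glued_valU (x y : L) : val (x `|` y) = val x `|` val y.
Proof. exact: Order.valU_subproof. Qed.

Lemma glued_val0 : val (\bot : L) = \bot.
Proof. exact: Order.val0_subproof. Qed.

Lemma glued_val1 : val (\top : L) = \top.
Proof. exact: Order.val1_subproof. Qed.

Fact glued_meetUl : @left_distributive L L Order.meet Order.join.
Proof.
by move=> x y z; apply: val_inj; rewrite !(glued_valI, glued_valU) meetUl.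
Qed.

HB.instance Definition _ :=
  Order.Lattice_Meet_isDistrLattice.Build _ L glued_meetUl.

(** The greatest element with first coordinate [x]; these turn out to be the closed elements. *)
Definition glue_closed (x : M) : L :=
  @Glued _ _ _ _ _ phi_hom (x, phi x) (lexx (phi x)).

Definition glued_circ (p : L) : L := glue_closed (circ (val p).1).

Fact glued_le_circ2 p : p <= glued_circ (glued_circ p).
Proof. by rewrite -Order.le_val; apply/andP; rewrite /= circK lexx (valP p). Qed.

Fact glued_circI p q : glued_circ (p `&` q) = glued_circ p `|` glued_circ q.
Proof.
by apply: val_inj; rewrite glued_valU /= circI phiU.
Qed.

Fact glued_circ1 : glued_circ \top = \bot.
Proof.
by apply: val_inj; rewrite glued_val0 /= circ1 phi0.
Qed.

HB.instance Definition _ := TBDistrLattice_isMSAlgebra.Build _ L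
  glued_le_circ2 glued_circI glued_circ1.

Fact top_pair_proof (y : D) : y <= phi \top. Proof. by rewrite phi1 lex1. Qed.

Definition glue_dense (y : D) : L :=
  @Glued _ _ _ _ _ phi_hom (\top, y) (top_pair_proof y).

Lemma glued_circ_eq0 (p : L) : (circ p == \bot) = ((val p).1 == \top).
Proof.
apply/eqP/eqP => [|p1].
  move/(congr1 (fun q : L => circ (val q).1)).
  by rewrite glued_val0 /= circK circ0.
by apply: val_inj; rewrite glued_val0 /= p1 circ1 phi0.
Qed.

Fact glued_dmin (p : L) : (circ p == \bot) = (glue_dense \bot <= p).
Proof.
rewrite glued_circ_eq0 -Order.le_val.
by apply/eqP/andP => /= [->|[+ _]]; rewrite ?lexx ?le0x // le1x => /eqP.
Qed.

(** For [p = (x, y)] the two factors are [(x, phi x)] and [(1, y)]; their meet is [(x, y)] precisely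
    because [y <= phi x]. *)
Fact glued_decomp (p : L) : p = circ (circ p) `&` (p `|` glue_dense \bot).
Proof.
case: p => -[x y] le_y; apply: val_inj; rewrite glued_valI glued_valU /= circK.
by rewrite joinEprod meetEprod /= joinx1 meetx1 joinx0 (meet_idPr le_y).
Qed.

HB.instance Definition _ := MSAlgebra_isPrincipal.Build _ L
  glued_dmin glued_decomp.

End GluedAlgebra.

(** * Skeleton and dense filter of the glued algebra *)

Section GluedRepresents.
Local Open Scope order_scope.
Context {d d' : Order.disp_t} {M : deMorganType d} {D : tbDistrLatticeType d'}.
Context {phi : M -> D} (phi_hom : lattice01_hom phi).
Local Notation L := (glued phi_hom).

Fact glue_closed_circ2 (x : M) :
  glue_closed phi_hom x == circ (circ (glue_closed phi_hom x)).
Proof. by apply/eqP/val_inj; rewrite /= circK. Qed.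

Definition glue_skeleton (x : M) : skeleton L :=
  Skeleton (glue_closed_circ2 x).

Fact glue_dense_circ (y : D) : circ (glue_dense phi_hom y) == \bot.
Proof. by rewrite glued_circ_eq0. Qed.

Definition glue_filter (y : D) : dense L := Dense (glue_dense_circ y).

Lemma glue_skeleton_iso : ms_iso glue_skeleton.
Proof.
have [phiI phiU phi0 phi1] := phi_hom.
split.
- split=> [x y|x y||]; apply: val_inj; apply: val_inj.
  + by rewrite skeleton_valI glued_valI /= phiI.
  + by rewrite skeleton_valU glued_valU /= phiU.
  + by rewrite skeleton_val0 glued_val0 /= phi0.
  + by rewrite skeleton_val1 glued_val1 /= phi1.
- by move=> x; apply: val_inj; apply: val_inj.
- exists (fun p => (glued_val _ (skeleton_val p)).1) => // p.
  (* A skeleton element equals its double [circ], which is determined by the first coordinate. *)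
  by do 2 apply: val_inj; rewrite /= [in RHS](eqP (valP p)) /= circK.
Qed.

Lemma glue_filter_iso : lattice01_iso glue_filter.
Proof.
split.
- split=> [x y|x y||]; apply: val_inj; apply: val_inj.
  + by rewrite dense_valI glued_valI meetEprod /= meetxx.
  + by rewrite dense_valU glued_valU joinEprod /= joinxx.
  + by [].
  + by rewrite dense_val1 glued_val1.
- exists (fun p => (glued_val _ (dense_val p)).2) => // p; do 2 apply: val_inj.
  (* Density forces the first coordinate to be [\top]. *)
  have := valP p; rewrite glued_circ_eq0 /= => /eqP.
  by case: (glued_val _ (dense_val p)) => x y /= ->.
Qed.

Lemma join_dmin_glue (x : M) :
  join_dmin (skeleton_val (glue_skeleton x)) = glue_filter (phi x).
Proof.
by do 2 apply: val_inj; rewrite /= joinEprod /= joinx1 joinx0.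
Qed.

Lemma representable_compatible_pairs : representable (compatible_pairs phi).
Proof.
exists _, L, glue_skeleton, glue_filter.
split; [exact: glue_skeleton_iso|exact: glue_filter_iso|].
apply/seteqP; split=> -[th1 th2] h;
  by apply/(ms_con_pair_map _ _ _ _ _ glue_skeleton_iso glue_filter_iso
    join_dmin_glue).
Qed.

End GluedRepresents.

(** * Representability in terms of [phi], and the theorem *)

Section RepresentableCompatible.
Local Open Scope order_scope.
Context {d d' : Order.disp_t} {M : deMorganType d} {D : tbDistrLatticeType d'}.

Lemma representableP (A : set (ms_con M *p lattice_con D)) :
  representable A <->
  exists2 phi : M -> D, lattice01_hom phi & A = compatible_pairs phi.
Proof.
split=> [[e [L [tau1 [tau2 [iso1 iso2 ->]]]]]|[phi phi_hom ->]]; last first.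
  exact: representable_compatible_pairs.
have [hom2 [sigma tauK sigmaK]] := iso2; have [[tI tU t0 t1] _ _] := iso1.
have [sI sU s0 s1] := lattice01_hom_inv _ _ _ _ hom2 tauK sigmaK.
have [jI jU j0 j1] := @join_dmin_hom _ L.
(* Joining with d_L, carried back to [D] by the inverse of [tau2]. *)
pose phi x := sigma (join_dmin (skeleton_val (tau1 x))).
exists phi.
  split=> [x y|x y||]; rewrite /phi.
  - by rewrite tI jI sI.
  - by rewrite tU jU sU.
  - by rewrite t0 j0 s0.
  - by rewrite t1 j1 s1.
have phiE x : join_dmin (skeleton_val (tau1 x)) = tau2 (phi x).
  by rewrite sigmaK.
by apply/seteqP; split=> -[th1 th2] h;
  apply/(ms_con_pair_map _ _ _ _ _ iso1 iso2 phiE).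
Qed.

End RepresentableCompatible.

Theorem theorem4p2 (d d' : Order.disp_t)
    (M : deMorganType d) (D : tbDistrLatticeType d')
    (A : set (ms_con M *p lattice_con D)) (hA : sublattice A) :
  representable A <->
  [/\ closed_joins A,
      down_closed1 A &
      exists phi : M -> D, lattice01_hom phi /\
        forall (th1 : ms_con M) (th2 : lattice_con D), principal_con th1 ->
          (A (th1, th2) <-> (con_map phi th1 <= th2)%O)].
Proof.
rewrite representableP; split=> [[phi phi_hom ->]|].
  split; [exact: compatible_pairs_joins|exact: compatible_pairs_down|].
  (* For compatible pairs the equivalence in (3) is the definition, for any [th1]. *)
  by exists phi.
move=> [A_joins A_down [phi [phi_hom A_principal]]].
by exists phi => //; apply: eq_compatible_pairs.
Qed.
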